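(* Let $G$ be a discrete abelian group with identity $e$, and let $A$ be a $C^*$-algebra which is topologically $G$-graded, with grading subspaces $\{A_g : g\in G\}$ and with $F:A\to A$ a bounded linear map such that $F(a)=a$ for all $a\in A_e$ and $F(a)=0$ for all $a\in A_g$ with $g\neq e$. Then there is a strongly continuous action $\alpha:\widehat G\to \operatorname{Aut} A$ of the Pontryagin dual $\widehat G$ on $A$ such that $$\alpha_\gamma(a)=\gamma(g)a\quad\text{for all } g\in G,\ a\in A_g,\ \gamma\in\widehat G,$$ and then $$F(a)=\int_{\widehat G}\alpha_\gamma(a)\,d\gamma\quad\text{for all } a\in A,$$ where the integral is with respect to normalised Haar measure on the compact group $\widehat G$.
   Context: A $C^*$-algebra $A$ is $G$-graded (in Exel's sense) if there is a family $\{A_g:g\in G\}$ of linearly independent closed linear subspaces of $A$ such that $a\in A_g$ and $b\in A_h$ imply $ab\in A_{gh}$ and $a^*\in A_{g^{-1}}$, and such that $A$ is the norm-closure of $\bigoplus_{g\in G}A_g$. A $G$-graded $C^*$-algebra $A$ is topologically graded if there is a bounded linear map $F:A\to A$ which is the identity on $A_e$ and vanishes on every $A_g$ with $g\neq e$. $\widehat G$ denotes the compact group of homomorphisms $\gamma:G\to\mathbb{T}=\{z\in\mathbb{C}:|z|=1\}$ with the topology of pointwise convergence. A strongly continuous action $\alpha$ of $\widehat G$ on $A$ is a group homomorphism $\gamma\mapsto\alpha_\gamma$ from $\widehat G$ into the group $\operatorname{Aut}A$ of $*$-automorphisms of $A$ such that $\gamma\mapsto\alpha_\gamma(a)$ is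 norm-continuous for each $a\in A$. *)

(* Defs.v *)
From HB Require Import structures.
From mathcomp Require Import all_boot all_order all_algebra.
From mathcomp Require Export complex.
From mathcomp Require Export all_classical all_reals all_analysis.
Set Implicit Arguments.
Unset Strict Implicit.
Unset Printing Implicit Defensive.
Import Order.TTheory GRing.Theory Num.Theory.
Import numFieldNormedType.Exports.

Local Open Scope classical_set_scope.
Local Open Scope complex_scope.
Local Open Scope ring_scope.

(* C*-algebras over the complex field R[i], not necessarily unital. The norm of
   an R[i]-normed module takes its (real, nonnegative) values in R[i]. *)
HB.mixin Record CompleteNormedModule_isCstarAlgebra (R : realType) A
    of CompleteNormedModule R[i] A := {
  cmul : A -> A -> A;
  cstar : A -> A;
  cmulA : associative cmul;
  cmulDl : left_distributive cmul +%R;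
  cmulDr : right_distributive cmul +%R;
  cscaleAl : forall (k : R[i]) (a b : A), k *: cmul a b = cmul (k *: a) b;
  cscaleAr : forall (k : R[i]) (a b : A), k *: cmul a b = cmul a (k *: b);
  cnormM : forall a b : A, `|cmul a b| <= `|a| * `|b|;
  cstarK : involutive cstar;
  cstarD : {morph cstar : a b / a + b};
  cstarZ : forall (k : R[i]) (a : A), cstar (k *: a) = conjc k *: cstar a;
  cstarM : forall a b : A, cstar (cmul a b) = cmul (cstar b) (cstar a);
  cnorm_star_mul : forall a : A, `|cmul (cstar a) a| = `|a| ^+ 2 }.

#[short(type="cstarAlgType")]
HB.structure Definition CstarAlgebra (R : realType) :=
  {A of CompleteNormedModule_isCstarAlgebra R A & CompleteNormedModule R[i] A}.

(* A discrete abelian group G is a zmodType, written additively: gh is g + h,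
   g^-1 is - g, and e is 0. *)
Record graded (R : realType) (G : zmodType) (A : cstarAlgType R)
    (Agr : G -> set A) : Prop := Graded {
  graded0 : forall g, Agr g 0;
  graded_linear : forall g (k : R[i]) (a b : A),
    Agr g a -> Agr g b -> Agr g (k *: a + b);
  graded_closed : forall g, closed (Agr g);
  graded_independent : forall (s : seq G) (x : G -> A), uniq s ->
    (forall g, Agr g (x g)) -> \sum_(g <- s) x g = 0 ->
    forall g, g \in s -> x g = 0;
  graded_mul : forall g h a b, Agr g a -> Agr h b -> Agr (g + h) (cmul a b);
  graded_star : forall g a, Agr g a -> Agr (- g) (cstar a);
  graded_dense :
    closure [set a | exists (s : seq G) (x : G -> A),
      (forall g, Agr g (x g)) /\ a = \sum_(g <- s) x g] = [set: A] }.

Definition topologically_graded_by (R : realType) (G : zmodType)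
    (A : cstarAlgType R) (Agr : G -> set A) (F : {linear A -> A}) : Prop :=
  [/\ graded Agr,
      exists M : R, forall a, `|F a| <= M%:C * `|a|,
      forall a, Agr 0 a -> F a = a &
      forall g a, g != 0 -> Agr g a -> F a = 0].

Record pontryagin_dual (R : realType) (G : zmodType) := Character {
  char_fun :> G -> R[i];
  charD : forall g h, char_fun (g + h) = char_fun g * char_fun h;
  char_norm1 : forall g, `|char_fun g| = 1 }.

HB.instance Definition _ (R : realType) (G : zmodType) :=
  gen_eqMixin (pontryagin_dual R G).
HB.instance Definition _ (R : realType) (G : zmodType) :=
  gen_choiceMixin (pontryagin_dual R G).

Section DualGroup.
Context {R : realType} {G : zmodType}.
Implicit Types x y z : pontryagin_dual R G.

Lemma dual_eqP x y : x =1 y -> x = y.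
Proof.
case: x y => [x xD x1] [y yD y1] /= /funext exy.
by case: _ / exy in yD y1 *; congr Character; exact: Prop_irrelevance.
Qed.

Lemma char_neq0 x g : x g != 0.
Proof. by rewrite -normr_eq0 char_norm1 oner_eq0. Qed.

Fact one_charD (g h : G) : 1 = 1 * 1 :> R[i]. Proof. by rewrite mulr1. Qed.
Fact one_char_norm1 (g : G) : `|1 : R[i]| = 1. Proof. exact: normr1. Qed.
Definition char_one : pontryagin_dual R G :=
  @Character R G (fun=> 1) one_charD one_char_norm1.

Fact mul_charD x y g h :
  x (g + h) * y (g + h) = x g * y g * (x h * y h).
Proof. by rewrite !charD mulrACA. Qed.
Fact mul_char_norm1 x y g : `|x g * y g| = 1.
Proof. by rewrite normrM !char_norm1 mulr1. Qed.
Definition char_mul x y : pontryagin_dual R G :=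
  @Character R G (fun g => x g * y g) (mul_charD x y) (mul_char_norm1 x y).

Fact inv_charD x g h : (x (g + h))^-1 = (x g)^-1 * (x h)^-1.
Proof. by rewrite charD invfM. Qed.
Fact inv_char_norm1 x g : `|(x g)^-1| = 1.
Proof. by rewrite normfV char_norm1 invr1. Qed.
Definition char_inv x : pontryagin_dual R G :=
  @Character R G (fun g => (x g)^-1) (inv_charD x) (inv_char_norm1 x).

Fact char_mulA : associative char_mul.
Proof. by move=> x y z; apply: dual_eqP => g /=; rewrite mulrA. Qed.
Fact char_mul1g : left_id char_one char_mul.
Proof. by move=> x; apply: dual_eqP => g /=; rewrite mul1r. Qed.
Fact char_mulg1 : right_id char_one char_mul.
Proof. by move=> x; apply: dual_eqP => g /=; rewrite mulr1. Qed.
Fact char_mulVg : left_inverse char_one char_inv char_mul.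
Proof. by move=> x; apply: dual_eqP => g /=; rewrite mulVf ?char_neq0. Qed.
Fact char_mulgV : right_inverse char_one char_inv char_mul.
Proof. by move=> x; apply: dual_eqP => g /=; rewrite mulfV ?char_neq0. Qed.

End DualGroup.

HB.instance Definition _ (R : realType) (G : zmodType) :=
  isGroup.Build (pontryagin_dual R G) char_mulA char_mul1g char_mulg1
    char_mulVg char_mulgV.
HB.instance Definition _ (R : realType) (G : zmodType) :=
  isPointed.Build (pontryagin_dual R G) char_one.

(* The topology of pointwise convergence. *)
HB.instance Definition _ (R : realType) (G : zmodType) :=
  Topological.copy (pontryagin_dual R G)
    (initial_topology (@char_fun R G : pontryagin_dual R G -> {ptws G -> R[i]^o})).

Definition borel_dual (R : realType) (G : zmodType) :=
  g_sigma_algebraType (@open (pontryagin_dual R G)).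

Definition star_automorphism (R : realType) (A : cstarAlgType R)
    (f : A -> A) : Prop :=
  [/\ bijective f,
      forall (k : R[i]) (a b : A), f (k *: a + b) = k *: f a + f b,
      {morph f : a b / cmul a b} &
      {morph f : a / cstar a}].

Definition strongly_continuous_action (R : realType) (G : zmodType)
    (A : cstarAlgType R) (alpha : pontryagin_dual R G -> A -> A) : Prop :=
  [/\ forall gamma, star_automorphism (alpha gamma),
      forall gamma delta a,
        alpha (gamma * delta)%g a = alpha gamma (alpha delta a) &
      forall a, continuous (fun gamma => alpha gamma a)].

(* Normalised Haar measure on the compact group: the translation-invariant
   Radon Borel probability. *)
Definition normalised_haar (R : realType) (G : zmodType)
    (mu : probability (borel_dual R G) R) : Prop :=
  [/\ forall (gamma : pontryagin_dual R G) (E : set (borel_dual R G)), measurable E ->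
        mu [set (gamma * delta)%g | delta in (E : set (pontryagin_dual R G))] = mu E,
      forall E : set (borel_dual R G), measurable E ->
        mu E = ereal_inf [set mu U | U in
          [set U : set (pontryagin_dual R G) | open U /\ E `<=` U]] &
      forall U : set (pontryagin_dual R G), open U ->
        mu U = ereal_sup [set mu K | K in
          [set K : set (pontryagin_dual R G) | compact K /\ K `<=` U]]].

Section Bochner.
Context d (T : measurableType d) (R : realType) (V : normedModType R[i]).

Definition simple_map (s : T -> V) : Prop :=
  finite_set (range s) /\ forall v, measurable (s @^-1` [set v]).

Definition simple_integral (mu : {finite_measure set T -> \bar R})
    (s : T -> V) : V :=
  \sum_(v \in range s) (fine (mu (s @^-1` [set v])))%:C *: v.

(* f is Bochner integrable with integral v. The a.e. convergence gives strong
   measurability of f, which convergence of the integrals alone does not: the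
   library integral is defined for non-measurable integrands too. *)
Definition is_bochner_integral (mu : {finite_measure set T -> \bar R})
    (f : T -> V) (v : V) : Prop :=
  exists s : nat -> T -> V,
    [/\ forall n, simple_map (s n),
        {ae mu, forall t, s n t @[n --> \oo] --> f t},
        (\int[mu]_t (complex.Re `|f t - s n t|)%:E)%E @[n --> \oo] --> 0%E &
        simple_integral mu (s n) @[n --> \oo] --> v].

End Bochner.

(* Main.v *)
Require Import Defs.
From mathcomp Require Import all_boot all_order all_algebra.
Set Implicit Arguments.
Unset Strict Implicit.
Unset Printing Implicit Defensive.
Import Order.TTheory GRing.Theory Num.Theory.
Import numFieldNormedType.Exports.
Local Open Scope classical_set_scope.
Local Open Scope complex_scope.
Local Open Scope ring_scope.
Import HBNNSimple.

(** The action is forced on finite sums of homogeneous elements: it must send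
    [\sum_g a_g] to [\sum_g gamma g *: a_g], and this rule respects products and
    stars there because [gamma] is a character.  Everything rests on showing that
    it is a contraction for the norm of [A]; it then extends to the closure.

    The bounded map [F] controls single components.  If [a = \sum_g a_g], then
    [F (a_g^* a) = a_g^* a_g], whence [|a_g|^2 <= M |a_g| |a|] and [|a_g| <= M |a|].
    Summing over the support gives [|twist a| <= M |supp a| |a|], a bound that is
    useless by itself but becomes sharp after taking powers.  Put [h = a^* a].  By
    the C*-identity [|h^(2^k)| = |a|^(2 * 2^k)], and the same holds for the twisted
    element.  As [G] is abelian, the support of [h^n] lies in a box with at most
    [(n + 1)^m] points, so that
    [|twist a|^(2 * 2^k) <= M (2^k + 1)^m |a|^(2 * 2^k)] for all [k].
    A polynomial factor cannot compensate an exponential gap, so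
    [|twist a| <= |a|] ([norm_twisted_sum_le]).  This replaces the usual appeal to
    amenability of [G].

    All identities satisfied by the extended maps hold on the dense set of finite
    sums, hence everywhere, since both sides are Lipschitz; strong continuity is
    clear on finite sums and passes to uniform limits.

    For the integral formula, it suffices to treat [gamma |-> gamma g *: x] with
    [x] in [A_g], as [F] is continuous and the maps [alpha gamma] are contractive.
    If [g = 0] the integrand is the constant [x = F x].  If [g != 0], some character
    [gamma0] has [gamma0 g != 1] ([characters_separate], by Zorn's lemma), and
    translating by [gamma0] multiplies the integral by [gamma0 g], so it vanishes,
    as does [F x] ([uniform_integral_char]).  Integrals are handled through uniform
    approximation by simple maps, on which the integral is additive, contractive
    and translation invariant; uniform approximation is stronger than Bochner
    integrability ([bochner_of_uniform]). *)

(** * Norms of complex numbers *)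

Lemma norm_complex (R : realType) (V : normedModType R[i]) (z : V) : `|z| = (complex.Re `|z|)%:C.
Proof.
have := normr_ge0 z; rewrite lecE /= => /andP[/eqP + _].
by case: `|z| => x y /= ->.
Qed.

Lemma gt0_complex (R : realType) (e : R[i]) : 0 < e -> e = (complex.Re e)%:C /\ 0 < complex.Re e.
Proof. by case: e => x y; rewrite ltcE /= => /andP[/eqP-> ->]. Qed.

Lemma Im_norm_le (R : realType) (z : R[i]) : `|complex.Im z|%:C <= `|z|.
Proof. by rewrite normc_def lecR -sqrtr_sqr ler_wsqrtr// lerDr sqr_ge0. Qed.

Lemma norm_le_ReD_Im (R : realType) (z : R[i]) : `|z| <= (`|complex.Re z| + `|complex.Im z|)%:C.
Proof.
rewrite normc_def lecR -[leRHS]ger0_norm ?addr_ge0// -sqrtr_sqr ler_wsqrtr//.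
by rewrite sqrrD !real_normK ?num_real// addrAC lerDl mulrn_wge0 ?mulr_ge0.
Qed.

(** * Polynomial growth in an abelian group, and the power trick *)

Lemma bernoulli_le (R : realDomainType) (d : R) n : 0 <= d -> 1 + n%:R * d <= (1 + d) ^+ n.
Proof.
move=> d0; elim: n => [|n IH]; first by rewrite mul0r addr0 expr0.
rewrite exprS; apply: le_trans (ler_wpM2l _ IH); last by rewrite addr_ge0.
rewrite mulrDl mul1r mulrDr mulr1 -natr1 mulrDl mul1r -addrA lerD2l.
by rewrite lerD2l lerDl !mulr_ge0.
Qed.

(** If [r > 1], the numbers [r ^+ (2 ^ j)] are unbounded by Bernoulli's inequality.
    Once one of them exceeds [2 * D], its further powers outgrow every
    [K * D ^+ k], because the exponent doubles each time [k] increases by one. *)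
Lemma expr_two_pow_bound (R : realType) (r K D : R) :
  0 <= r -> 0 <= K -> 1 <= D ->
  (forall k, r ^+ (2 ^ k) <= K * D ^+ k) -> r <= 1.
Proof.
move=> r0 K0 D1 H; have D0 : 0 < D by exact: lt_le_trans ltr01 D1.
have bnd j : r ^+ (2 ^ j) < 2 * D.
  rewrite ltNge; apply/negP => big.
  have /(@upper_nthrootP R) := leqnn (Num.bound (K * D ^+ j)).
  set i := Num.bound _; apply/negP; rewrite -leNgt.
  rewrite -(ler_pM2r (exprn_gt0 i D0)) -exprMn -mulrA -exprD.
  apply: le_trans (H (j + i)%N); rewrite expnD exprM.
  have D2 : 1 <= 2 * D by rewrite mulr_ege1// ler1n.
  have big1 := le_trans D2 big.
  apply: (@le_trans _ _ ((r ^+ (2 ^ j)) ^+ i)).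
    by apply: lerXn2r => //; rewrite nnegrE ?exprn_ge0// mulr_ge0// ltW.
  by rewrite ler_weXn2l// ltnW// ltn_expl.
rewrite leNgt; apply/negP => r1.
pose d := r - 1; have d0 : 0 < d by rewrite subr_gt0.
pose n := Num.bound (2 * D / d).
have := bnd n; apply/negP; rewrite -leNgt.
have -> : r = 1 + d by rewrite /d addrCA subrr addr0.
apply: le_trans (bernoulli_le _ (ltW d0)).
rewrite -[leLHS]add0r lerD//.
rewrite -ler_pdivrMr//; apply: ltW.
apply: lt_le_trans (archi_boundP _) _; first by rewrite divr_ge0// ?mulr_ge0// ltW.
by rewrite ler_nat ltnW// ltn_expl.
Qed.

(** The power trick: an inequality between all powers of exponent [2 ^ k] which is
    lossy by a factor polynomial in the exponent (and so geometric in [k]) is in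
    fact lossless. *)
Lemma le_of_expr_two_pow_bound (R : realType) (x y K D : R) :
  0 <= x -> 0 <= y -> 0 <= K -> 1 <= D ->
  (forall k, x ^+ (2 ^ k) <= K * D ^+ k * y ^+ (2 ^ k)) -> x <= y.
Proof.
move=> x0; rewrite le0r => /predU1P[->|y0] K0 D1 H.
  by have := H 0%N; rewrite !expr1 mulr0.
rewrite -[y]mul1r -ler_pdivrMr//.
apply: (expr_two_pow_bound _ K0 D1); first by rewrite divr_ge0// ltW.
by move=> k; rewrite expr_div_n ler_pdivrMr ?exprn_gt0.
Qed.

Section Boxes.
Context {G : zmodType}.

(** The sums [\sum_i k_i g_i] with all [k_i <= n], where [s] lists the [g_i].  Sums of
    [n] elements of [s] all have this form because the order of summation is
    irrelevant; this is where commutativity of [G] makes the growth polynomial. *)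
Fixpoint box (n : nat) (s : seq G) : seq G :=
  if s is g :: s' then [seq g *+ i + h | i <- iota 0 n.+1, h <- box n s']
  else [:: 0].

Lemma size_box n s : size (box n s) = (n.+1 ^ size s)%N.
Proof.
elim: s => // g s IH; apply: etrans (size_allpairs _ _ _) _.
by rewrite size_iota IH expnS.
Qed.

Lemma box_consP n g s k :
  reflect (exists i h, [/\ (i <= n)%N, h \in box n s & k = g *+ i + h])
    (k \in box n (g :: s)).
Proof.
apply: (iffP idP) => [/allpairsP[[i h] [/= ii hs ->]]|[i [h [ile hs ->]]]].
  by have : i \in iota 0 n.+1 := ii; rewrite mem_iota => /= ile; exists i, h.
apply/allpairsP; exists (i, h); split=> //.
by suff : i \in iota 0 n.+1 by []; rewrite mem_iota.
Qed.

Lemma box0 n s : 0 \in box n s.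
Proof.
elim: s => [|g s IH]; first by rewrite inE.
by apply/box_consP; exists 0%N, 0; rewrite mulr0n addr0.
Qed.

Lemma sub_box1 s : {subset s <= box 1 s}.
Proof.
elim: s => // g s IH h; rewrite inE => /predU1P[->|hs]; apply/box_consP.
  by exists 1%N, 0; rewrite addr0 box0.
by exists 0%N, h; rewrite mulr0n add0r IH.
Qed.

Lemma boxD n m s g h : g \in box n s -> h \in box m s -> g + h \in box (n + m) s.
Proof.
elim: s g h => [|k s IH] g h; first by rewrite !inE => /eqP-> /eqP->; rewrite addr0.
move=> /box_consP[i [g' [ile gs ->]]] /box_consP[j [h' [jle hs ->]]].
apply/box_consP; exists (i + j)%N, (g' + h'); split.
- exact: leq_add.
- exact: IH.
by rewrite mulrnDr addrACA.
Qed.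

End Boxes.

(** * Lipschitz maps, and extension of contractions by density *)

Section Lipschitz.
Context {R : realType} {V : normedModType R[i]}.

Definition lipschitz_map (f : V -> V) : Prop :=
  exists2 C : R[i], 0 <= C & forall a b, `|f a - f b| <= C * `|a - b|.

Lemma lipschitz_comp f g : lipschitz_map f -> lipschitz_map g -> lipschitz_map (f \o g).
Proof.
move=> [C C0 fC] [D D0 gD]; exists (C * D); first exact: mulr_ge0.
by move=> a b; apply: le_trans (fC _ _) _; rewrite -mulrA ler_wpM2l.
Qed.

(** Used to transport algebraic identities from finite homogeneous sums to the whole
    algebra, one variable at a time. *)
Lemma eq_of_lipschitz_dense (D : V -> Prop) f g :
  (forall a e, 0 < e -> exists2 a', D a' & `|a - a'| < e) ->
  lipschitz_map f -> lipschitz_map g -> (forall a, D a -> f a = g a) -> f =1 g.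
Proof.
move=> dense [C C0 fC] [K K0 gK] fg a; apply/eqP; rewrite -subr_eq0 -normr_le0.
apply/ler_addgt0Pl => e e0; rewrite addr0.
have CK0 : 0 < C + K + 1 by rewrite ltr_wpDl// addr_ge0.
have [a' Da' lt] := dense a (e / (C + K + 1)) (divr_gt0 e0 CK0).
rewrite -[f a](addrNK (f a')) -addrA; apply: le_trans (ler_normD _ _) _.
rewrite {2}(fg _ Da').
apply: (@le_trans _ _ (C * `|a - a'| + K * `|a - a'|)).
  by apply: lerD; rewrite ?fC// distrC [in leRHS]distrC distrC gK.
rewrite -mulrDl; apply: (@le_trans _ _ ((C + K + 1) * `|a - a'|)).
  by rewrite ler_wpM2r// lerDl.
by rewrite mulrC -ler_pdivlMr// ltW.
Qed.

Lemma lipschitz_id : lipschitz_map (@id V).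
Proof. by exists 1 => // a b; rewrite mul1r. Qed.

Lemma lipschitz_add (c : V) : lipschitz_map (+%R c).
Proof.
by exists 1 => // a b; rewrite mul1r opprD addrACA subrr add0r.
Qed.

Lemma lipschitz_scale (k : R[i]) : lipschitz_map (fun a : V => k *: a).
Proof. by exists `|k| => // a b; rewrite -scalerBr normrZ. Qed.

End Lipschitz.

(** The map is given by its graph [Gr], so it need not be known beforehand to be
    single valued: contractivity forces this.  The value at [a] is the limit of the
    filter generated by the [b'] with [Gr a' b'] and [a'] close to [a].  The
    conclusion characterises [f] and is all that is used of it later. *)
Lemma contractive_extension (R : realType) (V : completeNormedModType R[i])
    (Gr : V -> V -> Prop) :
  (forall a e, 0 < e -> exists a' b', Gr a' b' /\ `|a - a'| < e) ->
  (forall a b a' b', Gr a b -> Gr a' b' -> `|b - b'| <= `|a - a'|) ->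
  exists f : V -> V, forall a a' b', Gr a' b' -> `|f a - b'| <= `|a - a'|.
Proof.
move=> dense contr.
suff H a : exists b, forall a' b', Gr a' b' -> `|b - b'| <= `|a - a'|.
  by have [f fP] := choice H; exists f.
pose B (e : R) := [set b' | exists2 a', Gr a' b' & `|a - a'| < e%:C].
pose FF := filter_from [set e : R | 0 < e] B.
have filFF : Filter FF.
  apply: filter_from_filter; first by exists 1; rewrite /= ltr01.
  move=> e e' e0 e'0; exists (Num.min e e'); first by rewrite /= lt_min e0.
  move=> b' [a' gr lt]; split; exists a' => //; apply: lt_le_trans lt _.
    by rewrite lecR ge_min lexx.
  by rewrite lecR ge_min lexx orbT.
have propFF : ProperFilter FF.
  apply: filter_from_proper => e /= e0.
  by have [|a' [b' [gr lt]]] := dense a e%:C; [rewrite ltcR|exists b', a'].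
have cvgFF : cvg FF.
  apply: cauchy_cvg; apply: cauchy_exP => e e0.
  have [|a' [b' [gr lt]]] := dense a (e / 2); first by rewrite divr_gt0.
  have [eE re0] := gt0_complex e0.
  exists b'; exists (complex.Re e / 2); first by rewrite /= divr_gt0.
  move=> b'' [a'' gr' lt']; rewrite -ball_normE /=.
  apply: le_lt_trans (contr _ _ _ _ gr gr') _.
  rewrite [e]splitr -[a'](addrNK a) -addrA.
  apply: le_lt_trans (ler_normD _ _) _; apply: ltrD; first by rewrite distrC.
  apply: lt_le_trans lt' _.
  by rewrite {2}eE rmorphM fmorphV rmorph_nat.
exists (lim FF) => a' b' gr; apply/ler_addgt0Pl => e e0.
have [eE re0] := gt0_complex e0.
have lt_lim : \forall b'' \near FF, `|lim FF - b''| < e / 2.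
  by apply: (cvgr_dist_lt id) => //; rewrite divr_gt0.
have lt_a : \forall b'' \near FF, B (complex.Re e / 2) b''.
  by exists (complex.Re e / 2) => //=; rewrite divr_gt0.
have [b'' [lt [a'' gr'' lt'']]] := filter_ex (filterI lt_lim lt_a).
rewrite -[lim FF](addrNK b'') -addrA.
apply: le_trans (ler_normD _ _) _.
rewrite [e]splitr -addrA; apply: lerD; first exact: ltW.
apply: le_trans (contr _ _ _ _ gr'' gr) _.
rewrite -[a''](addrNK a) -addrA.
apply: le_trans (ler_normD _ _) _; rewrite lerD2r distrC.
apply: ltW; apply: lt_le_trans lt'' _.
by rewrite {2}eE rmorphM fmorphV rmorph_nat.
Qed.

(** * Elementary identities in a C*-algebra *)

Section CstarBasics.
Context {R : realType} {A : cstarAlgType R}.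
Implicit Types a b c : A.

Lemma cmul0l a : cmul 0 a = 0.
Proof. by apply: (addrI (cmul 0 a)); rewrite -cmulDl !addr0. Qed.
Lemma cmul0r a : cmul a 0 = 0.
Proof. by apply: (addrI (cmul a 0)); rewrite -cmulDr !addr0. Qed.
Lemma cstar0 : cstar (0 : A) = 0.
Proof. by apply: (addrI (cstar 0)); rewrite -cstarD !addr0. Qed.
Lemma cmulNl a b : cmul (- a) b = - cmul a b.
Proof. by apply: (addrI (cmul a b)); rewrite -cmulDl !subrr cmul0l. Qed.
Lemma cmulNr a b : cmul a (- b) = - cmul a b.
Proof. by apply: (addrI (cmul a b)); rewrite -cmulDr !subrr cmul0r. Qed.
Lemma cstarN a : cstar (- a) = - cstar a.
Proof. by apply: (addrI (cstar a)); rewrite -cstarD !subrr cstar0. Qed.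

Lemma cmul_suml I (s : seq I) (P : pred I) (f : I -> A) b :
  cmul (\sum_(i <- s | P i) f i) b = \sum_(i <- s | P i) cmul (f i) b.
Proof. by apply: (big_morph (cmul^~ b)) => [x y|]; rewrite ?cmulDl ?cmul0l. Qed.
Lemma cmul_sumr I (s : seq I) (P : pred I) (f : I -> A) b :
  cmul b (\sum_(i <- s | P i) f i) = \sum_(i <- s | P i) cmul b (f i).
Proof. by apply: (big_morph (cmul b)) => [x y|]; rewrite ?cmulDr ?cmul0r. Qed.
Lemma cstar_sum I (s : seq I) (P : pred I) (f : I -> A) :
  cstar (\sum_(i <- s | P i) f i) = \sum_(i <- s | P i) cstar (f i).
Proof. by apply: (big_morph cstar) => [x y|]; rewrite ?cstarD ?cstar0. Qed.

(** From [|a|^2 = |a^* a| <= |a^*| |a|] and the same for [a^*]. *)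
Lemma cnorm_star a : `|cstar a| = `|a|.
Proof.
suff le_star b : `|b| <= `|cstar b|.
  by apply: le_anti; rewrite le_star -{2}[a]cstarK le_star.
have [->|b0] := eqVneq b 0; first by rewrite cstar0.
rewrite -(ler_pM2r (_ : 0 < `|b|)) ?normr_gt0// -expr2 -cnorm_star_mul.
exact: cnormM.
Qed.

(** Only exponents [2 ^ k] are considered, since for these the C*-identity gives
    the norm of a power directly by repeated squaring. *)
Lemma norm_iter_square (h : A) k : cstar h = h ->
  `|iter k (fun x => cmul x x) h| = `|h| ^+ (2 ^ k).
Proof.
move=> hsa; have sa j : cstar (iter j (fun x => cmul x x) h) = iter j (fun x => cmul x x) h.
  by elim: j => //= j IH; rewrite cstarM IH.
elim: k => [|k IH]; first by rewrite expr1.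
by rewrite iterS -[X in cmul X _]sa cnorm_star_mul IH -exprM expnSr.
Qed.

Lemma lipschitz_mull (c : A) : lipschitz_map (cmul c).
Proof. by exists `|c| => // a b; rewrite -cmulNr -cmulDr cnormM. Qed.

Lemma lipschitz_mulr (c : A) : lipschitz_map (cmul^~ c).
Proof. by exists `|c| => // a b; rewrite -cmulNl -cmulDl mulrC cnormM. Qed.

Lemma lipschitz_star : lipschitz_map (@cstar R A).
Proof. by exists 1 => // a b; rewrite -cstarN -cstarD cnorm_star mul1r. Qed.

End CstarBasics.

(** * Formal sums of homogeneous elements *)

Section FormalSums.
Context {R : realType} {G : zmodType} {A : cstarAlgType R} (Agr : G -> set A).
Implicit Types (L : seq (G * A)) (gamma : pontryagin_dual R G).

(** A list of pairs (degree, element) is a formal sum.  Working with lists, rather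
    than with elements of the algebra, gives a twist that is defined before the
    decomposition into homogeneous components is known to be unique. *)
Definition homogeneous L := forall p, p \in L -> Agr p.1 p.2.

Definition twisted_sum gamma L : A := \sum_(p <- L) gamma p.1 *: p.2.

(** The element represented by a formal sum is its twist by the trivial character,
    so each identity for [twisted_sum] also holds for [total]. *)
Definition total L : A := twisted_sum char_one L.

Definition lmul L L' : seq (G * A) :=
  [seq (p.1 + q.1, cmul p.2 q.2) | p <- L, q <- L'].
Definition lstar L : seq (G * A) := [seq (- p.1, cstar p.2) | p <- L].
Definition lscale (k : R[i]) L : seq (G * A) := [seq (p.1, k *: p.2) | p <- L].
Definition ltwist gamma L : seq (G * A) := [seq (p.1, gamma p.1 *: p.2) | p <- L].
Definition component g L : A := \sum_(p <- L | p.1 == g) p.2.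

Lemma char0 gamma : gamma 0 = 1.
Proof.
apply: (mulfI (char_neq0 gamma 0)).
by rewrite -charD addr0 mulr1.
Qed.

Lemma charN gamma g : gamma (- g) = (gamma g)^-1.
Proof.
apply: (mulfI (char_neq0 gamma g)).
by rewrite -charD subrr char0 mulfV ?char_neq0.
Qed.

Lemma charV gamma g : (gamma g)^-1 = conjc (gamma g).
Proof.
by rewrite invc_norm char_norm1 expr1n invr1 mul1r.
Qed.

Lemma totalE L : total L = \sum_(p <- L) p.2.
Proof. by apply: eq_bigr => p _; rewrite scale1r. Qed.

Lemma twisted_sum_cat gamma L L' :
  twisted_sum gamma (L ++ L') = twisted_sum gamma L + twisted_sum gamma L'.
Proof. exact: big_cat. Qed.

Lemma twisted_sum_scale gamma k L :
  twisted_sum gamma (lscale k L) = k *: twisted_sum gamma L.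
Proof.
rewrite /twisted_sum big_map scaler_sumr; apply: eq_bigr => p _ /=.
by rewrite !scalerA mulrC.
Qed.

Lemma twisted_sum_twist gamma delta L :
  twisted_sum gamma (ltwist delta L) = twisted_sum (gamma * delta)%g L.
Proof.
by rewrite /twisted_sum big_map; apply: eq_bigr => p _; rewrite scalerA.
Qed.

Lemma twisted_sum_mul gamma L L' :
  twisted_sum gamma (lmul L L') = cmul (twisted_sum gamma L) (twisted_sum gamma L').
Proof.
rewrite /twisted_sum big_flatten big_map cmul_suml; apply: eq_bigr => p _.
rewrite big_map cmul_sumr; apply: eq_bigr => q _ /=.
by rewrite charD -cscaleAl -cscaleAr scalerA.
Qed.

Lemma twisted_sum_star gamma L :
  twisted_sum gamma (lstar L) = cstar (twisted_sum gamma L).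
Proof.
rewrite /twisted_sum big_map cstar_sum; apply: eq_bigr => p _ /=.
by rewrite cstarZ charN charV.
Qed.

(** Grouping equal degrees bounds the number of terms by the size of the support
    instead of the length of the list, which grows exponentially under squaring. *)
Lemma twisted_sum_component gamma L (s : seq G) :
  uniq s -> {subset [seq p.1 | p <- L] <= s} ->
  twisted_sum gamma L = \sum_(g <- s) gamma g *: component g L.
Proof.
move=> us sub.
under eq_bigr do rewrite scaler_sumr.
rewrite (exchange_big_dep predT)//= /twisted_sum !big_seq.
apply: eq_bigr => p pL.
rewrite (eq_bigl (pred1 p.1)); last by move=> g /=; rewrite eq_sym.
rewrite -big_filter filter_pred1_uniq ?big_seq1//.
by apply: sub; apply: map_f.
Qed.

End FormalSums.

(** * Twisting by a character is contractive *)

Section Contraction.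
Context {R : realType} {G : zmodType} {A : cstarAlgType R}.
Context (Agr : G -> set A) (F : {linear A -> A}).
Hypothesis gradedA : topologically_graded_by Agr F.
Implicit Types (L : seq (G * A)) (gamma : pontryagin_dual R G).

Let grA : graded Agr. Proof. by case: gradedA. Qed.

Lemma AgrD g a b : Agr g a -> Agr g b -> Agr g (a + b).
Proof. by move=> ga gb; rewrite -[a]scale1r; apply: (graded_linear grA). Qed.

Lemma AgrZ g k a : Agr g a -> Agr g (k *: a).
Proof.
by move=> ga; rewrite -[_ *: _]addr0; apply: (graded_linear grA) => //; apply: graded0.
Qed.

Lemma homogeneous_cat L L' :
  homogeneous Agr L -> homogeneous Agr L' -> homogeneous Agr (L ++ L').
Proof. by move=> hL hL' p; rewrite mem_cat => /orP[/hL|/hL']. Qed.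

Lemma homogeneous_scale k L : homogeneous Agr L -> homogeneous Agr (lscale k L).
Proof. by move=> hL p /mapP[q /hL qA ->]; apply: AgrZ. Qed.

Lemma homogeneous_twist gamma L : homogeneous Agr L -> homogeneous Agr (ltwist gamma L).
Proof. by move=> hL p /mapP[q /hL qA ->]; apply: AgrZ. Qed.

Lemma homogeneous_mul L L' :
  homogeneous Agr L -> homogeneous Agr L' -> homogeneous Agr (lmul L L').
Proof.
move=> hL hL' p /allpairsP[[q q'] /= [/hL qA /hL' qA' ->]].
exact: (graded_mul grA).
Qed.

Lemma homogeneous_star L : homogeneous Agr L -> homogeneous Agr (lstar L).
Proof. by move=> hL p /mapP[q /hL qA ->]; apply: (graded_star grA). Qed.

Lemma component_Agr g L : homogeneous Agr L -> Agr g (component g L).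
Proof.
move=> hL; rewrite /component big_seq_cond.
elim/big_ind : _ => [|a b|p /andP[/hL + /eqP <-]//]; first exact: graded0.
exact: AgrD.
Qed.

Lemma F_Agr g a : Agr g a -> F a = if g == 0 then a else 0.
Proof.
case: gradedA => _ _ F1 F0; have [->|g0] := eqVneq g 0; first exact: F1.
exact: F0.
Qed.

(** With [c] the component, [cstar c] has degree [- g], so in [cmul (cstar c) (total L)]
    only the terms of degree [g] land in degree [0]: [F] extracts [cmul (cstar c) c],
    of norm [`|c| ^+ 2]. *)
Lemma norm_component_le (M : R) g L : (forall a, `|F a| <= M%:C * `|a|) ->
  homogeneous Agr L -> `|component g L| <= M%:C * `|total L|.
Proof.
move=> FM hL; set c := component g L.
have [->|c0] := eqVneq c 0.
  by rewrite normr0 (le_trans _ (FM _))// normr_ge0.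
have Ec : F (cmul (cstar c) (total L)) = cmul (cstar c) c.
  rewrite totalE cmul_sumr linear_sum {3}/c /component cmul_sumr [RHS]big_mkcond /=.
  rewrite big_seq [RHS]big_seq; apply: eq_bigr => p pL.
  rewrite (@F_Agr (- g + p.1)); last first.
    apply: (graded_mul grA); last exact: hL.
    by apply: (graded_star grA); apply: component_Agr.
  by rewrite addrC subr_eq0.
rewrite -(ler_pM2r (_ : 0 < `|c|)) ?normr_gt0// -expr2 -cnorm_star_mul -Ec.
apply: le_trans (FM _) _; rewrite -mulrA.
have M0 : 0 <= M%:C :> R[i].
  have := le_trans (normr_ge0 _) (FM c).
  by rewrite pmulr_lge0 ?normr_gt0.
rewrite ler_wpM2l// (le_trans (cnormM _ _))// cnorm_star mulrC.
exact: lexx.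
Qed.

Lemma norm_twisted_sum_le_card (M : R) gamma L (s : seq G) :
  (forall a, `|F a| <= M%:C * `|a|) ->
  homogeneous Agr L -> {subset [seq p.1 | p <- L] <= s} ->
  `|twisted_sum gamma L| <= (size s)%:R * (M%:C * `|total L|).
Proof.
move=> FM hL sub.
have M0 : 0 <= M%:C * `|total L| by apply: le_trans (FM _); exact: normr_ge0.
rewrite (@twisted_sum_component _ _ _ _ _ (undup s)) ?undup_uniq//; last first.
  by move=> g /sub; rewrite mem_undup.
apply: le_trans (ler_norm_sum _ _ _) _.
apply: (@le_trans _ _ (\sum_(g <- undup s) M%:C * `|total L|)).
  by apply: ler_sum => g _; rewrite normrZ char_norm1 mul1r norm_component_le.
rewrite big_const_seq count_predT iter_addr_0 -[leLHS]mulr_natl.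
by rewrite ler_wpM2r// ler_nat size_undup.
Qed.

Lemma twisted_sum_iter gamma k L :
  twisted_sum gamma (iter k (fun L => lmul L L) L) =
  iter k (fun x => cmul x x) (twisted_sum gamma L).
Proof. by elim: k => //= k IH; rewrite twisted_sum_mul IH. Qed.

Lemma homogeneous_iter k L :
  homogeneous Agr L -> homogeneous Agr (iter k (fun L => lmul L L) L).
Proof. by move=> hL; elim: k => //= k IH; apply: homogeneous_mul. Qed.

Lemma degrees_iter k L :
  {subset [seq p.1 | p <- iter k (fun L => lmul L L) L]
     <= box (2 ^ k) [seq p.1 | p <- L]}.
Proof.
elim: k => [|k IH] /=; first exact: sub_box1.
move=> g /mapP[_ /allpairsP[[p q] /= [pL qL ->]] ->] /=.
by rewrite expnS mul2n -addnn; apply: boxD; apply: IH; apply: map_f.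
Qed.

(** The crude bound [norm_twisted_sum_le_card] is applied to the powers of the
    self-adjoint element [a^* a], and the power trick removes its constants. *)
Lemma norm_twisted_sum_le gamma L :
  homogeneous Agr L -> `|twisted_sum gamma L| <= `|total L|.
Proof.
move=> hL; have [_ [M FM] _ _] := gradedA.
set b := twisted_sum _ _; set a := total L.
pose H := lmul (lstar L) L; pose m := size [seq p.1 | p <- H].
have hH : homogeneous Agr H by apply: homogeneous_mul => //; exact: homogeneous_star.
have normsq gam k : `|twisted_sum gam (iter k (fun L => lmul L L) H)| =
    (`|twisted_sum gam L| ^+ 2) ^+ (2 ^ k).
  rewrite twisted_sum_iter norm_iter_square twisted_sum_mul twisted_sum_star.
    by rewrite cnorm_star_mul.
  by rewrite cstarM cstarK.
suff : complex.Re `|b| ^+ 2 <= complex.Re `|a| ^+ 2.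
  rewrite ler_sqr ?nnegrE; first by rewrite (norm_complex b) (norm_complex a) lecR.
  - by rewrite -(@lecR R) -norm_complex normr_ge0.
  - by rewrite -(@lecR R) -norm_complex normr_ge0.
apply: (@le_of_expr_two_pow_bound _ _ _ ((2 ^ m)%:R * `|M|) ((2 ^ m)%:R)).
- exact: exprn_even_ge0.
- exact: exprn_even_ge0.
- exact: mulr_ge0.
- by rewrite ler1n expn_gt0.
move=> k.
have p0 : 0 <= (complex.Re `|a| ^+ 2) ^+ (2 ^ k).
  by apply: exprn_ge0; exact: exprn_even_ge0.
(* the support of the power lies in a box with [(2 ^ k).+1 ^ m] points, which is at
   most [2 ^ m * (2 ^ m) ^ k] *)
have card_le : ((2 ^ k).+1 ^ m)%:R <= (2 ^ m)%:R * (2 ^ m)%:R ^+ k :> R.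
  rewrite -natrX -natrM ler_nat -expnM -expnD -mulnS mulnC expnM.
  have [->|m0] := posnP m; first by rewrite !expn0.
  by rewrite leq_exp2r//  expnS mul2n -addnn -addn1 leq_add2l expn_gt0.
have := norm_twisted_sum_le_card gamma FM (homogeneous_iter (k := k) hH) (@degrees_iter k H).
rewrite size_box -/m /total !normsq -/b -/(total L) -/a.
rewrite (norm_complex b) (norm_complex a) -(rmorph_nat (real_complex R)).
have -> (x : R) : x%:C ^+ 2 ^+ (2 ^ k) = (x ^+ 2 ^+ (2 ^ k))%:C by rewrite !rmorphXn.
have -> (x : R) : x%:C ^+ 2 ^+ (2 ^ k) = (x ^+ 2 ^+ (2 ^ k))%:C by rewrite !rmorphXn.
rewrite -!rmorphM lecR. move=> /le_trans; apply.
rewrite mulrA (ler_wpM2r p0)// mulrAC.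
apply: (@le_trans _ _ (((2 ^ k).+1 ^ m)%:R * `|M|)).
  by rewrite ler_wpM2l// ler_norm.
by rewrite ler_wpM2r.
Qed.

End Contraction.
(** * The dual action *)

Section Action.
Context {R : realType} {G : zmodType} {A : cstarAlgType R}.
Context (Agr : G -> set A) (F : {linear A -> A}).
Hypothesis gradedA : topologically_graded_by Agr F.
Implicit Types (L : seq (G * A)) (gamma : pontryagin_dual R G).

Lemma dense_homogeneous a (e : R[i]) : 0 < e ->
  exists2 L, homogeneous Agr L & `|a - total L| < e.
Proof.
move=> e0; have [gr _ _ _] := gradedA.
have cl : [set: A] a by [].
rewrite -(graded_dense gr) in cl.
have [_ [[s [x [xA ->]]]]] := cl _ (nbhsx_ballx a e e0).
rewrite -ball_normE /= => lt.
exists [seq (g, x g) | g <- s]; first by move=> p /mapP[g _ ->]; apply: xA.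
by rewrite totalE big_map.
Qed.

(** The displayed inequality determines [alpha gamma]: taking [a = total L] shows
    that it extends the twist, and approximating [a] that it is continuous. *)
Lemma exists_dual_extension :
  exists alpha : pontryagin_dual R G -> A -> A,
    forall gamma a L, homogeneous Agr L ->
      `|alpha gamma a - twisted_sum gamma L| <= `|a - total L|.
Proof.
suff H gamma : exists f : A -> A, forall a L, homogeneous Agr L ->
    `|f a - twisted_sum gamma L| <= `|a - total L|.
  by have [f fP] := choice H; exists f.
pose Gr a b := exists2 L, homogeneous Agr L & a = total L /\ b = twisted_sum gamma L.
have [||f fP] := @contractive_extension R A Gr.
- move=> a e /(dense_homogeneous a) [L hL lt].
  by exists (total L), (twisted_sum gamma L); split=> //; exists L.
- move=> a b a' b' [L hL [-> ->]] [L' hL' [-> ->]].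
  have := norm_twisted_sum_le gradedA gamma
    (homogeneous_cat hL (homogeneous_scale gradedA (k := -1) hL')).
  by rewrite /total !twisted_sum_cat !twisted_sum_scale !scaleN1r.
by exists f => a L hL; apply: fP; exists L.
Qed.

Context (alpha : pontryagin_dual R G -> A -> A).
Hypothesis alphaP : forall gamma a L, homogeneous Agr L ->
  `|alpha gamma a - twisted_sum gamma L| <= `|a - total L|.

Lemma alpha_total gamma L : homogeneous Agr L -> alpha gamma (total L) = twisted_sum gamma L.
Proof.
move=> hL; apply/eqP; rewrite -subr_eq0 -normr_le0.
by apply: le_trans (alphaP _ _ hL) _; rewrite subrr normr0.
Qed.

Lemma alpha_contraction gamma a b : `|alpha gamma a - alpha gamma b| <= `|a - b|.
Proof.
apply/ler_addgt0Pl => e e0.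
have [L hL lt] := dense_homogeneous b (divr_gt0 e0 (ltr0Sn _ 1)).
rewrite -[alpha gamma a](addrNK (twisted_sum gamma L)) -addrA.
apply: le_trans (ler_normD _ _) _.
apply: (@le_trans _ _ (`|a - total L| + `|b - total L|)).
  by apply: lerD; rewrite ?alphaP// distrC alphaP.
apply: (@le_trans _ _ (`|a - b| + `|b - total L| + `|b - total L|)).
  by rewrite lerD2r -[a in leLHS](addrNK b) -addrA ler_normD.
by rewrite -addrA addrC lerD2r [e]splitr lerD// ltW.
Qed.

Lemma lipschitz_alpha gamma : lipschitz_map (alpha gamma).
Proof. by exists 1 => // a b; rewrite mul1r alpha_contraction. Qed.

Lemma eq_by_density (f g : A -> A) : lipschitz_map f -> lipschitz_map g ->
  (forall L, homogeneous Agr L -> f (total L) = g (total L)) -> f =1 g.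
Proof.
move=> lf lg fg.
apply: (@eq_of_lipschitz_dense _ _ (fun a => exists2 L, homogeneous Agr L & a = total L)) => //.
  by move=> a e /(dense_homogeneous a) [L hL lt]; exists (total L) => //; exists L.
by move=> _ [L hL ->]; exact: fg.
Qed.

Lemma alphaD gamma a b : alpha gamma (a + b) = alpha gamma a + alpha gamma b.
Proof.
move: a; apply: eq_by_density.
- have -> : (fun a => alpha gamma (a + b)) = alpha gamma \o +%R b.
    by apply/funext => a /=; rewrite addrC.
  exact: lipschitz_comp (lipschitz_alpha _) (lipschitz_add _).
- have -> : (fun a => alpha gamma a + alpha gamma b) = +%R (alpha gamma b) \o alpha gamma.
    by apply/funext => a /=; rewrite addrC.
  exact: lipschitz_comp (lipschitz_add _) (lipschitz_alpha _).
move=> L hL; move: b; apply: eq_by_density.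
- exact: lipschitz_comp (lipschitz_alpha _) (lipschitz_add _).
- exact: lipschitz_comp (lipschitz_add _) (lipschitz_alpha _).
move=> L' hL'.
by rewrite /total -twisted_sum_cat !alpha_total ?twisted_sum_cat//; exact: homogeneous_cat.
Qed.

Lemma alphaZ gamma k a : alpha gamma (k *: a) = k *: alpha gamma a.
Proof.
move: a; apply: eq_by_density.
- exact: lipschitz_comp (lipschitz_alpha _) (lipschitz_scale _).
- exact: lipschitz_comp (lipschitz_scale _) (lipschitz_alpha _).
move=> L hL; rewrite /total -twisted_sum_scale !alpha_total ?twisted_sum_scale//.
exact: (homogeneous_scale gradedA).
Qed.

Lemma alphaM gamma a b : alpha gamma (cmul a b) = cmul (alpha gamma a) (alpha gamma b).
Proof.
move: a; apply: eq_by_density.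
- exact: lipschitz_comp (lipschitz_alpha _) (lipschitz_mulr _).
- exact: (lipschitz_comp (lipschitz_mulr (alpha gamma b)) (lipschitz_alpha _)).
move=> L hL; move: b; apply: eq_by_density.
- exact: lipschitz_comp (lipschitz_alpha _) (lipschitz_mull _).
- exact: lipschitz_comp (lipschitz_mull _) (lipschitz_alpha _).
move=> L' hL'.
rewrite /total -twisted_sum_mul !alpha_total ?twisted_sum_mul//.
exact: (homogeneous_mul gradedA).
Qed.

Lemma alpha_star gamma a : alpha gamma (cstar a) = cstar (alpha gamma a).
Proof.
move: a; apply: eq_by_density.
- exact: lipschitz_comp (lipschitz_alpha _) lipschitz_star.
- exact: lipschitz_comp lipschitz_star (lipschitz_alpha _).
move=> L hL; rewrite /total -twisted_sum_star !alpha_total ?twisted_sum_star//.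
exact: (homogeneous_star gradedA).
Qed.

Lemma alpha_comp gamma delta a : alpha (gamma * delta)%g a = alpha gamma (alpha delta a).
Proof.
move: a; apply: eq_by_density.
- exact: lipschitz_alpha.
- exact: lipschitz_comp (lipschitz_alpha _) (lipschitz_alpha _).
move=> L hL; rewrite !alpha_total//.
have <- : total (ltwist delta L) = twisted_sum delta L.
  by rewrite /total twisted_sum_twist; congr twisted_sum; exact: char_mul1g.
rewrite alpha_total ?twisted_sum_twist//.
exact: (homogeneous_twist gradedA).
Qed.

Lemma alpha1 a : alpha 1%g a = a.
Proof. by move: a; apply: eq_by_density (lipschitz_alpha _) lipschitz_id _ => L /alpha_total->. Qed.

Lemma alpha_star_automorphism gamma : star_automorphism (alpha gamma).
Proof.
split.
- by exists (alpha (gamma^-1)%g) => a; rewrite -alpha_comp ?mulVg ?mulgV alpha1.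
- by move=> k a b; rewrite alphaD alphaZ.
- exact: alphaM.
- exact: alpha_star.
Qed.

Lemma char_eval_continuous (g : G) :
  continuous (fun gamma : pontryagin_dual R G => gamma g : R[i]^o).
Proof.
move=> gamma.
have char_cont := @initial_continuous _ _
  (@char_fun R G : pontryagin_dual R G -> {ptws G -> R[i]^o}) gamma.
exact: continuous_comp char_cont (@proj_continuous G (fun=> R[i]^o) g _).
Qed.

Lemma twisted_sum_continuous L : continuous (fun gamma => twisted_sum gamma L).
Proof.
elim: L => [|p L IH] gamma.
  have -> : (fun gamma => twisted_sum gamma [::]) = fun=> 0 :> A.
    by apply/funext => delta; rewrite /twisted_sum big_nil.
  exact: cst_continuous.
have -> : (fun gamma => twisted_sum gamma (p :: L)) =
    fun gamma => gamma p.1 *: p.2 + twisted_sum gamma L.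
  by apply/funext => delta; rewrite /twisted_sum big_cons.
have c1 : gamma' p.1 *: p.2 @[gamma' --> gamma] --> gamma p.1 *: p.2.
  exact: (@cvgZr_tmp _ A _ (nbhs gamma) _ (fun g' : pontryagin_dual R G => g' p.1)
    (gamma p.1) p.2 (@char_eval_continuous p.1 gamma)).
exact: (@cvgD _ A _ (nbhs gamma) _ _ _ _ _ c1 (IH gamma)).
Qed.

(** A uniform limit, over the dual group, of the maps of
    [twisted_sum_continuous]. *)
Lemma alpha_continuous a : continuous (fun gamma => alpha gamma a).
Proof.
move=> gamma; apply/(@cvgrPdist_lt _ A _ (nbhs gamma) _ (fun g' => alpha g' a)) => e e0.
have e30 : 0 < e / 3 by rewrite divr_gt0.
have [L hL lt] := dense_homogeneous a e30.
have /(@cvgrPdist_lt _ A _ (nbhs gamma) _ (fun g' => twisted_sum g' L))/(_ _ e30) :=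
  @twisted_sum_continuous L gamma.
apply: filterS => delta /= ltL.
have -> : alpha gamma a - alpha delta a = (alpha gamma a - twisted_sum gamma L) +
    (twisted_sum gamma L - twisted_sum delta L) + (twisted_sum delta L - alpha delta a).
  by rewrite !addrA !addrNK.
have -> : e = e / 3 + e / 3 + e / 3.
  by rewrite -addrA -[RHS]/(e / 3 *+ 3) -mulr_natr divfK ?pnatr_eq0.
apply: le_lt_trans (ler_normD _ _) _; apply: ltrD.
  apply: le_lt_trans (ler_normD _ _) _; apply: ltrD => //.
  exact: le_lt_trans (alphaP _ _ hL) lt.
rewrite distrC; exact: le_lt_trans (alphaP _ _ hL) lt.
Qed.

End Action.
(** * Characters separate the points of an abelian group *)

Section PartialCharacters.
Context {R : realType} {G : zmodType}.
Implicit Types (X : set (G * R[i])) (p q : G * R[i]).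

(** The graph of a unitary character defined on a subgroup of [G].  In the presence
    of the closure under quotients, single-valuedness reduces to the third clause.
    Graphs are used because an increasing union of graphs is again one. *)
Definition partial_character X : Prop :=
  [/\ X (0, 1),
      forall p q, X p -> X q -> X (p.1 - q.1, p.2 / q.2),
      forall z, X (0, z) -> z = 1 &
      forall p, X p -> `|p.2| = 1].

Section Theory.
Context X (pcX : partial_character X).

Lemma partial_character_fun g z z' : X (g, z) -> X (g, z') -> z = z'.
Proof.
have [_ XB X0 X1] := pcX => Xz Xz'.
have z'0 : z' != 0 by rewrite -normr_eq0 (X1 _ Xz') oner_eq0.
have /= := XB _ _ Xz Xz'; rewrite subrr => /X0 /(congr1 ( *%R^~ z')).
by rewrite divfK// mul1r.
Qed.

Lemma partial_characterN p : X p -> X (- p.1, p.2^-1).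
Proof.
have [X01 XB _ _] := pcX => Xp.
by have := XB _ _ X01 Xp; rewrite /= sub0r div1r.
Qed.

Lemma partial_characterD p q : X p -> X q -> X (p.1 + q.1, p.2 * q.2).
Proof.
have [_ XB _ _] := pcX => Xp /partial_characterN Xq.
by have := XB _ _ Xp Xq; rewrite /= opprK invrK.
Qed.

Lemma partial_characterMz p (k : int) : X p -> X (p.1 *~ k, p.2 ^ k).
Proof.
have [X01 _ _ _] := pcX => Xp.
have Xn n : X (p.1 *+ n, p.2 ^+ n).
  elim: n => [|n IH]; first by rewrite mulr0n expr0.
  by rewrite mulrS exprS; exact: (partial_characterD Xp IH).
case: k => n; first exact: Xn.
by rewrite NegzE mulrNz -invr_expz; exact: (partial_characterN (Xn n.+1)).
Qed.

(** The condition under which [h |-> w] extends the partial character [X] to the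
    subgroup generated by its domain and [h]. *)
Definition compatible_value (h : G) (w : R[i]) : Prop :=
  `|w| = 1 /\ forall (k : int) z, X (h *~ k, z) -> w ^ k = z.

Lemma partial_character_extend h w : compatible_value h w ->
  exists Y, [/\ partial_character Y, X `<=` Y & Y (h, w)].
Proof.
have [X01 XB X0 X1] := pcX => -[w1 wP].
have w0 : w != 0 by rewrite -normr_eq0 w1 oner_eq0.
exists [set p | exists q (k : int), X q /\ p = (q.1 + h *~ k, q.2 * w ^ k)].
split; last 2 first.
- by move=> [g z] Xp; exists (g, z), 0; rewrite mulr0z addr0 expr0z mulr1.
- by exists (0, 1), 1; rewrite mulr1z add0r expr1z mul1r.
split.
- by exists (0, 1), 0; rewrite mulr0z addr0 expr0z mulr1.
- move=> _ _ [p [k [Xp ->]]] [q [l [Xq ->]]].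
  exists (p.1 - q.1, p.2 / q.2), (k - l); split; first exact: XB.
  congr pair => /=; first by rewrite mulrzBr opprD addrACA.
  by rewrite expfzDr// -invr_expz invfM mulrACA.
- move=> z [q [k [Xq [e ->]]]].
  have := partial_characterN Xq; have -> : - q.1 = h *~ k.
    by apply: (addrI q.1); rewrite -e subrr.
  move=> /wP ->; rewrite mulfV// -normr_eq0 X1// oner_eq0.
- move=> _ [q [k [Xq ->]]] /=; rewrite normrM X1// mul1r.
  by case: k => k; rewrite ?NegzE -?invr_expz ?normfV normrX w1 expr1n ?invr1.
Qed.

(** The multiples of [h] in the domain are exactly the multiples of [h *+ n], so
    the only constraint on the value at [h] is that its [n]-th power be [z]. *)
Lemma compatible_of_root h n z w : (0 < n)%N -> X (h *+ n, z) ->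
  (forall m z', (0 < m)%N -> X (h *+ m, z') -> (n <= m)%N) ->
  w ^+ n = z -> compatible_value h w.
Proof.
have [X01 XB X0 X1] := pcX => n0 Xn nmin wn.
have w1 : `|w| = 1.
  by apply/eqP; rewrite -(@pexpr_eq1 _ _ n)// -normrX wn (X1 _ Xn).
split=> // k z' Xk.
have Xq := partial_characterMz (k %/ n)%Z Xn.
have /= := XB _ _ Xk Xq.
have -> : h *~ k - h *+ n *~ (k %/ n)%Z = h *~ (k %% n)%Z.
  by rewrite {1}(divz_eq k n) mulrzDr [_ * n%:Z]mulrC mulrzA addrAC subrr add0r.
have : (0 <= k %% n)%Z by rewrite modz_ge0// -lt0n.
have : (k %% n < n)%Z by rewrite ltz_pmod.
case: (_ %% _)%Z (divz_eq k n) => // r kE rn _ Xr.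
have r0 : r = 0%N.
  apply/eqP; rewrite -leqn0 leqNgt; apply/negP => r0.
  by have := nmin _ _ r0 Xr; rewrite leqNgt; move: rn; rewrite ltz_nat => ->.
have {}kE : k = n%:Z * (k %/ n)%Z by rewrite {1}kE r0 addr0 mulrC.
have {}Xk : X (h *+ n *~ (k %/ n)%Z, z') by rewrite [_ *~ _](_ : _ = h *~ k)// {2}kE mulrzA.
by rewrite -(partial_character_fun Xq Xk) {1}kE -exprz_exp -wn.
Qed.

(** Roots exist because the complex numbers are algebraically closed; this is the
    divisibility of the circle group.  If no multiple of [h] lies in the domain,
    any value is allowed. *)
Lemma exists_compatible_value h : exists w, compatible_value h w.
Proof.
have [X01 XB X0 X1] := pcX.
have [fin|inf] := pselect (exists n, (0 < n)%N && `[< exists z, X (h *+ n, z) >]).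
  case: (ex_minnP fin) => n /andP[n0 /asboolP[z Xz]] nmin.
  exists (n.-root z); apply: (compatible_of_root n0 Xz); last by rewrite rootCK.
  by move=> m z' m0 Xm; apply: nmin; rewrite m0; apply/asboolP; exists z'.
exists 1; split; first by rewrite normr1.
move=> k z Xk; rewrite exp1rz; apply/esym.
have noX n z' : X (h *+ n, z') -> n = 0%N.
  case: n => // n Xn; exfalso; apply: inf; exists n.+1 => /=.
  by apply/asboolP; exists z'.
case: k Xk => n; first by move=> /[dup] /noX ->; rewrite mulr0z; exact: X0.
rewrite NegzE mulrNz => /partial_characterN /=.
by rewrite opprK => /noX.
Qed.

End Theory.

(** A root of [1 + X + ... + X^(n-1)]; it is not [1], where this takes the value [n]. *)
Lemma exists_nontrivial_unity_root n : (1 < n)%N -> exists2 w : R[i], w != 1 & w ^+ n = 1.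
Proof.
move=> n1; pose P : {poly R[i]} := \poly_(i < n) 1.
have sP : size P = n by rewrite size_poly_eq ?oner_eq0.
have /closed_rootP[w rw] : size P != 1%N by rewrite sP gtn_eqF.
have Pw : P.[w] = \sum_(i < n) w ^+ i.
  by rewrite horner_poly; apply: eq_bigr => i _; rewrite mul1r.
move: rw; rewrite rootE Pw => /eqP rw.
exists w; last by apply/eqP; rewrite -subr_eq0 subrX1 rw mulr0.
apply: contra_eq_neq rw => ->; under eq_bigr do rewrite expr1n.
by rewrite sumr_const card_ord pnatr_eq0 -lt0n ltnW.
Qed.

Lemma partial_character_trivial : partial_character [set (0, 1)].
Proof.
split=> //=.
- by move=> p q -> ->; rewrite subr0 divr1.
- by move=> z [].
- by move=> p ->; rewrite normr1.
Qed.

Lemma exists_nontrivial_partial_character (g : G) : g != 0 ->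
  exists X w, [/\ partial_character X, X (g, w) & w != 1].
Proof.
move=> g0; have pc0 := partial_character_trivial.
suff [w cw w1] : exists2 w, compatible_value [set (0, 1)] g w & w != 1.
  by have [Y [pcY _ Yg]] := partial_character_extend pc0 cw; exists Y, w.
have [fin|inf] := pselect (exists n, (0 < n)%N && (g *+ n == 0)).
  case: (ex_minnP fin) => n /andP[n0 /eqP gn] nmin.
  have n1 : (1 < n)%N.
    by case: n n0 gn {nmin} => // -[|//] _; rewrite mulr1n => /eqP; rewrite (negPf g0).
  have [w w1 wn] := exists_nontrivial_unity_root n1.
  exists w => //; apply: (compatible_of_root pc0 n0 _ _ wn); first by rewrite gn.
  by move=> m z' m0 /= [gm _]; apply: nmin; rewrite m0 gm eqxx.
exists (-1); last by rewrite -subr_eq0 -opprD oppr_eq0 -[1 + 1]/(2%:R) pnatr_eq0.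
split; first by rewrite normrN normr1.
have no n : g *+ n = 0 -> n = 0%N.
  by case: n => // n gn; exfalso; apply: inf; exists n.+1; rewrite /= gn eqxx.
move=> [] n z /= [gn ->]; first by rewrite (no _ gn) expr0z.
by move/eqP: gn; rewrite NegzE mulrNz oppr_eq0 => /eqP /no.
Qed.

(** Zorn's lemma yields a maximal partial character above one that is nontrivial at
    [g]; it is total since any element can still be adjoined to its domain. *)
Lemma characters_separate (g : G) : g != 0 ->
  exists gamma : pontryagin_dual R G, gamma g != 1.
Proof.
move=> /exists_nontrivial_partial_character[X0 [w0 [pc0 X0g w01]]].
(* Zorn's lemma is applied to the sets whose union with [X0] is a partial character,
   so that the empty chain has an upper bound. *)
have [|A [pcA Amax]] := @Zorn_bigcup _ [set X | partial_character (X0 `|` X)].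
  move=> C Cpc Ctot /=.
  (* The chain condition: any two points of the union lie in one member. *)
  have common p q : (X0 `|` \bigcup_(X in C) X) p -> (X0 `|` \bigcup_(X in C) X) q ->
      exists Y, [/\ partial_character Y, Y p, Y q & Y `<=` X0 `|` \bigcup_(X in C) X].
    have sub X : C X -> X0 `|` X `<=` X0 `|` \bigcup_(X in C) X.
      by move=> CX r [Xr|Xr]; [left|right; exists X].
    move=> [Xp|[X CX Xp]] [Xq|[Y CY Yq]].
    - by exists X0; split=> //; exact: classical_sets.subsetUl.
    - by exists (X0 `|` Y); split; [exact: Cpc|left|right|exact: sub].
    - by exists (X0 `|` X); split; [exact: Cpc|right|left|exact: sub].
    - have [XY|YX] := Ctot _ _ CX CY.
        by exists (X0 `|` Y); split; [exact: Cpc|right; exact: XY|right|exact: sub].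
      by exists (X0 `|` X); split; [exact: Cpc|right|right; exact: YX|exact: sub].
  split.
  - by left; have [] := pc0.
  - by move=> p q Up Uq; have [Y [[_ YB _ _] Yp Yq]] := common _ _ Up Uq; apply; exact: YB.
  - by move=> z Uz; have [Y [[_ _ Y0 _] Yz _ _]] := common _ _ Uz Uz; exact: Y0.
  - by move=> p Up; have [Y [[_ _ _ Y1] Yp _ _]] := common _ _ Up Up; exact: Y1.
set B := X0 `|` A in pcA.
have Bmax Y : partial_character Y -> B `<=` Y -> Y `<=` B.
  move=> pcY BY; apply: contrapT => YB; apply: (Amax Y).
    split; first by apply: classical_sets.subset_trans BY; exact: classical_sets.subsetUr.
    move=> YA; apply: YB; apply: classical_sets.subset_trans YA _.
    exact: classical_sets.subsetUr.
  rewrite /= classical_sets.setUidr//.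
  by apply: classical_sets.subset_trans BY; exact: classical_sets.subsetUl.
have Btot g' : exists z, B (g', z).
  have [w cw] := exists_compatible_value pcA g'.
  have [Y [pcY BY Yw]] := partial_character_extend pcA cw.
  by exists w; exact: (Bmax Y).
have [f fP] := choice Btot.
have [_ _ _ B1] := pcA.
have fD g1 g2 : f (g1 + g2) = f g1 * f g2.
  exact: (partial_character_fun pcA (fP _) (partial_characterD pcA (fP g1) (fP g2))).
exists (@Character R G f fD (fun g => B1 _ (fP g))) => /=.
by rewrite (partial_character_fun pcA (fP g) (_ : B (g, w0)))//; left.
Qed.

End PartialCharacters.
(** * Integrals of simple maps and of their uniform limits *)

Section SimpleIntegral.
Context d (T : measurableType d) (R : realType) (V : normedModType R[i]).
Context (mu : probability T R).

(** Same as [simple_map], but with values in an arbitrary type: two simple maps can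
    then be put over a common partition by pairing them. *)
Definition finitely_valued (I : choiceType) (p : T -> I) : Prop :=
  finite_set (range p) /\ forall i, measurable (p @^-1` [set i]).

Section Fibers.
Context {I : choiceType} {p : T -> I} (fp : finitely_valued p).

Lemma finitely_valued_range : exists2 r : seq I, uniq r & range p = [set` r].
Proof.
have [/finite_fsetP[r rE] _] := fp.
by exists (finmap.enum_fset r) => //; exact: finmap.fset_uniq.
Qed.

Lemma preimage_bigcup (B : set I) (r : seq I) : range p = [set` r] ->
  p @^-1` B = \bigcup_(i in [set` [seq i <- r | `[< B i >]]]) p @^-1` [set i].
Proof.
move=> rE; apply/seteqP; split=> t /=.
  move=> Bt; exists (p t) => //=; rewrite mem_filter; apply/andP; split; first exact/asboolP.
  have : range p (p t) by exists t.
  by rewrite rE.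
by move=> [i /=]; rewrite mem_filter => /andP[/asboolP Bi _] ->.
Qed.

Lemma measurable_preimage (B : set I) : measurable (p @^-1` B).
Proof.
have [r _ rE] := finitely_valued_range.
rewrite (preimage_bigcup B rE); apply: fin_bigcup_measurable; first exact: finite_seq.
by move=> i _; have [_] := fp; apply.
Qed.

Lemma measure_preimage (B : set I) (r : seq I) : uniq r -> range p = [set` r] ->
  fine (mu (p @^-1` B)) = \sum_(i <- r | `[< B i >]) fine (mu (p @^-1` [set i])).
Proof.
move=> ur rE; have [_ mp] := fp.
rewrite [in LHS](preimage_bigcup B rE).
rewrite (measure_fin_bigcup mu (finite_seq _) _ (fun i _ => mp i)); last first.
  by move=> i j _ _ [t [<- <-]].
rewrite -fsbig_seq ?filter_uniq// big_filter.
under eq_bigr do rewrite -(fineK (fin_num_measure mu _ (mp _))).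
by rewrite sumEFin.
Qed.

Lemma finitely_valued_comp (J : choiceType) (f : I -> J) : finitely_valued (f \o p).
Proof.
split; last by move=> j; rewrite comp_preimage; exact: measurable_preimage.
have [fin _] := fp; rewrite (_ : range (f \o p) = f @` range p); first exact: finite_image.
by rewrite image_comp.
Qed.

Lemma finitely_valued_pair (J : choiceType) (q : T -> J) : finitely_valued q ->
  finitely_valued (fun t => (p t, q t)).
Proof.
have [finp mp] := fp => -[finq mq]; split.
  apply: sub_finite_set (finite_setX finp finq) => _ [t _ <-].
  by split; exists t.
move=> [i j]; rewrite (_ : _ @^-1` _ = p @^-1` [set i] `&` q @^-1` [set j]).
  exact: measurableI.
by apply/seteqP; split=> t /= [-> ->].
Qed.

(** Computes the integral of a simple map from any partition on whose blocks it is
    constant.  Additivity and the norm bound follow by choosing the partition. *)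
Lemma simple_integral_comp (f : I -> V) (r : seq I) : uniq r -> range p = [set` r] ->
  simple_integral mu (f \o p) = \sum_(i <- r) (fine (mu (p @^-1` [set i])))%:C *: f i.
Proof.
move=> ur rE; rewrite /simple_integral.
have -> : range (f \o p) = [set` undup [seq f i | i <- r]].
  have -> : range (f \o p) = f @` range p by rewrite image_comp.
  rewrite rE; apply/seteqP; split=> v /=.
    by move=> [i ir <-]; rewrite mem_undup; apply: map_f.
  by rewrite mem_undup => /mapP[i ir ->]; exists i.
rewrite -fsbig_seq ?undup_uniq//.
under eq_bigr => v _.
  rewrite comp_preimage (measure_preimage _ ur rE) rmorph_sum scaler_suml.
  over.
rewrite (exchange_big_dep predT)//= [LHS]big_seq [RHS]big_seq; apply: eq_bigr => i ir.
rewrite (eq_bigl (pred1 (f i))); last first.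
  by move=> v /=; apply/asboolP/eqP => ->.
rewrite -big_filter filter_pred1_uniq ?undup_uniq ?big_seq1//.
by rewrite mem_undup map_f.
Qed.

End Fibers.

Lemma simple_integralD (s t : T -> V) : simple_map s -> simple_map t ->
  simple_integral mu (fun x => s x + t x) = simple_integral mu s + simple_integral mu t.
Proof.
move=> ss st; have fp := finitely_valued_pair ss st.
have [r ur rE] := finitely_valued_range fp.
have eqc (f : V * V -> V) := simple_integral_comp fp f ur rE.
rewrite [LHS](eqc (fun v => v.1 + v.2)) [X in X + _](eqc fst) [X in _ + X](eqc snd).
by rewrite -big_split; apply: eq_bigr => i _; rewrite scalerDr.
Qed.

Lemma simple_mapD (s t : T -> V) : simple_map s -> simple_map t -> simple_map (fun x => s x + t x).
Proof.
move=> ss st; exact: (finitely_valued_comp (finitely_valued_pair ss st) (fun v => v.1 + v.2)).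
Qed.

Lemma simple_integralZ (k : R[i]) (s : T -> V) : simple_map s ->
  simple_integral mu (fun x => k *: s x) = k *: simple_integral mu s.
Proof.
move=> ss; have [r ur rE] := finitely_valued_range ss.
have eqc (f : V -> V) := simple_integral_comp ss f ur rE.
rewrite [LHS](eqc ( *:%R k)) [X in _ *: X](eqc id) scaler_sumr.
by apply: eq_bigr => i _; rewrite !scalerA mulrC.
Qed.

Lemma simple_mapZ (k : R[i]) (s : T -> V) : simple_map s -> simple_map (fun x => k *: s x).
Proof. by move=> ss; exact: (finitely_valued_comp ss ( *:%R k)). Qed.

Lemma probability_nonempty : [set: T] !=set0.
Proof.
apply/set0P/negP => /eqP T0; have := probability_setT mu.
by rewrite T0 measure0 => /esym/eqP; rewrite onee_eq0.
Qed.

Lemma simple_integral_cst (v : V) : simple_integral mu (fun _ : T => v) = v.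
Proof.
have [t _] := probability_nonempty.
rewrite /simple_integral (_ : range _ = [set v]).
  rewrite fsbig_set1 (_ : fine _ = 1) ?scale1r//.
  rewrite -[RHS]/(fine 1%:E) -(probability_setT mu); congr (fine (mu _)).
  by apply/seteqP; split.
by apply/seteqP; split=> w /= => [[_ _ <-]|->] //; exists t.
Qed.

Lemma simple_map_cst (v : V) : simple_map (fun _ : T => v).
Proof.
split; first by apply: (sub_finite_set _ (finite_set1 v)) => _ [t _ <-].
move=> w; have [->|vw] := eqVneq w v.
  by rewrite (_ : _ @^-1` _ = [set: T]); [exact: measurableT|apply/seteqP; split].
rewrite (_ : _ @^-1` _ = classical_sets.set0); first exact: measurable0.
by apply/seteqP; split=> // t /= vw'; move: vw; rewrite vw' eqxx.
Qed.

Lemma norm_simple_integral_le (s : T -> V) (c : R[i]) : simple_map s -> (forall t, `|s t| <= c) ->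
  `|simple_integral mu s| <= c.
Proof.
move=> ss sc; have [r ur rE] := finitely_valued_range ss.
rewrite (simple_integral_comp ss id ur rE).
have mu0 v : 0 <= (fine (mu (s @^-1` [set v])))%:C :> R[i].
  by rewrite lecR; apply: fine_ge0; exact: measure_ge0.
apply: le_trans (ler_norm_sum _ _ _) _.
apply: (@le_trans _ _ (\sum_(v <- r) (fine (mu (s @^-1` [set v])))%:C * c)).
  rewrite big_seq [leRHS]big_seq; apply: ler_sum => v vr.
  have : range s v by rewrite rE.
  by move=> [t _ <-]; rewrite normrZ (ger0_norm (mu0 _)) (ler_wpM2l (mu0 _)).
rewrite -mulr_suml -rmorph_sum.
have := measure_preimage ss [set: V] ur rE; rewrite preimage_setT probability_setT.
under [in X in _ = X -> _]eq_bigl do rewrite asboolT//.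
by move=> <-; rewrite mul1r.
Qed.

Lemma simple_integral_invariant (tau : T -> T) (s : T -> V) :
  (forall t, exists t', tau t' = t) ->
  (forall E, measurable E -> mu (tau @^-1` E) = mu E) ->
  simple_map s -> simple_integral mu (s \o tau) = simple_integral mu s.
Proof.
move=> surj inv [_ ms]; rewrite /simple_integral (_ : range (s \o tau) = range s).
  apply: eq_fsbigr => v _; congr ((fine _)%:C *: v).
  by rewrite comp_preimage; exact: inv.
apply/seteqP; split=> [_ [t _ <-]|_ [t _ <-]]; first by exists (tau t).
by have [t' <-] := surj t; exists t'.
Qed.

(** Integrability as a uniform limit of simple maps.  On a probability space this
    implies Bochner integrability, and it is stable under uniform limits. *)
Definition uniform_integral (f : T -> V) (v : V) : Prop :=
  forall e : R[i], 0 < e -> exists s,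
    [/\ simple_map s, forall t, `|f t - s t| <= e & `|v - simple_integral mu s| <= e].

Lemma uniform_integralD f g v w : uniform_integral f v -> uniform_integral g w ->
  uniform_integral (fun t => f t + g t) (v + w).
Proof.
move=> fv gw e e0; have e20 : 0 < e / 2 by rewrite divr_gt0.
have [s [ss fs vs]] := fv _ e20; have [s' [ss' gs ws]] := gw _ e20.
exists (fun t => s t + s' t); split.
- exact: simple_mapD.
- move=> t; rewrite opprD addrACA [e]splitr.
  by apply: le_trans (ler_normD _ _) _; apply: lerD.
- rewrite simple_integralD// opprD addrACA [e]splitr.
  by apply: le_trans (ler_normD _ _) _; apply: lerD.
Qed.

Lemma uniform_integral_lim f v :
  (forall e : R[i], 0 < e -> exists g w,
    [/\ uniform_integral g w, forall t, `|f t - g t| <= e & `|v - w| <= e]) ->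
  uniform_integral f v.
Proof.
move=> H e e0; have e20 : 0 < e / 2 by rewrite divr_gt0.
have [g [w [gw fg vw]]] := H _ e20; have [s [ss gs ws]] := gw _ e20.
exists s; split=> //.
- move=> t; rewrite -[f t](addrNK (g t)) -addrA [e]splitr.
  by apply: le_trans (ler_normD _ _) _; apply: lerD.
- rewrite -[v](addrNK w) -addrA [e]splitr.
  by apply: le_trans (ler_normD _ _) _; apply: lerD.
Qed.

Lemma uniform_integral_cst v : uniform_integral (fun _ : T => v) v.
Proof.
move=> e e0; exists (fun=> v); rewrite simple_integral_cst subrr normr0.
by split=> //; [exact: simple_map_cst|move=> _; exact: ltW|exact: ltW].
Qed.

(** The integral of a nonnegative function is the supremum of the integrals of the
    simple functions below it, so measurability of [f] is not an issue. *)
Lemma integral_le_cst (f : T -> R) (c : R) :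
  (forall t, 0 <= f t) -> (forall t, f t <= c) -> (\int[mu]_t (f t)%:E <= c%:E)%E.
Proof.
move=> f0 fc.
have [t _] := probability_nonempty.
have c0 : 0 <= c := le_trans (f0 t) (fc t).
rewrite ge0_integralTE; last by move=> x; rewrite lee_fin.
apply: ge_ereal_sup => _ [h hf <-].
rewrite -integralT_nnsfun.
apply: (@le_trans _ _ (\int[mu]_x c%:E)%E); last first.
  rewrite (integral_cst mu measurableT) -[leRHS]mule1.
  rewrite [X in (_ * X <= _)%E](_ : _ = 1%E); last exact: (probability_setT mu).
  exact: lexx.
apply: (ge0_le_integral mu measurableT).
- by move=> x _; rewrite lee_fin.
- by apply/measurable_realfun.measurable_EFinP; exact: measurable_funP.
- exact: measurable_cst.
- by move=> x _; rewrite lee_fin; apply: le_trans (fc x); rewrite -lee_fin hf.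
Qed.

Lemma bochner_of_uniform f v : uniform_integral f v -> is_bochner_integral mu f v.
Proof.
move=> fv.
have e0 n : 0 < (n.+1%:R^-1 : R)%:C by rewrite ltcR invr_gt0.
have [s sP] := choice (fun n => fv _ (e0 n)).
have small (e : R[i]) : 0 < e -> \forall n \near \oo, (n.+1%:R^-1 : R)%:C < e.
  move=> /gt0_complex[-> e1].
  near=> n; rewrite ltcR; near: n; exact: near_infty_natSinv_lt (PosNum e1).
exists s; split.
- by move=> n; have [] := sP n.
- apply: aeW => t; apply/cvgrPdist_lt => e /small; apply: filterS => n.
  by apply: le_lt_trans; have [_ + _] := sP n; apply.
- apply: (@squeeze_cvge _ _ _ _ (fun=> 0%E) _ (fun n => (n.+1%:R^-1 : R)%:E)); last 2 first.
  + exact: cvg_cst.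
  + exact: (@cvge_harmonic R).
  apply: nearW => n; have [_ fs _] := sP n.
  have ReN t := esym (norm_complex (f t - s n t)).
  have R0 t : 0 <= complex.Re `|f t - s n t| by rewrite -lecR ReN normr_ge0.
  apply/andP; split; first by apply: integral_ge0 => t _; rewrite lee_fin.
  by apply: integral_le_cst => // t; rewrite -lecR ReN.
- apply/cvgrPdist_lt => e /small; apply: filterS => n.
  by apply: le_lt_trans; have [_ _ +] := sP n.
Unshelve. all: by end_near. Qed.

End SimpleIntegral.
(** * Averaging over the dual group *)

Section HaarIntegral.
Context {R : realType} {G : zmodType}.
Implicit Types gamma delta : pontryagin_dual R G.

Lemma open_char_lt (phi : R[i] -> R) (g : G) (n : nat) (c : R) :
  (forall z w, `|phi z - phi w|%:C <= `|z - w|) ->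
  open [set gamma : pontryagin_dual R G | (phi (gamma g) + 1) * n.+1%:R < c].
Proof.
move=> phi1; rewrite openE => gamma /= lt; rewrite /interior.
pose d := (c - (phi (gamma g) + 1) * n.+1%:R) / n.+1%:R.
have d0 : 0 < d%:C :> R[i] by rewrite ltcR divr_gt0// subr_gt0.
have near_gamma :=
  @cvgr_dist_lt _ _ _ (nbhs gamma) (nbhs_filter gamma) _ _ (@char_eval_continuous R G g gamma) _ d0.
apply: (@filterS _ (nbhs gamma) _ _ _ _ near_gamma) => delta /= near_delta.
have : phi (delta g) - phi (gamma g) < d.
  apply: le_lt_trans (ler_norm _) _.
  by rewrite -ltcR distrC; apply: le_lt_trans (phi1 _ _) near_delta.
rewrite /d ltr_pdivlMr// mulrBl ltrBrDr.
by rewrite !mulrDl addrA addrNK.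
Qed.

(** The fibre over [k] is a difference of two sets [phi (gamma g) < c], which are open. *)
Lemma finitely_valued_truncn (phi : R[i] -> R) (g : G) (n : nat) :
  (forall z w, `|phi z - phi w|%:C <= `|z - w|) ->
  (forall z, `|phi z|%:C <= `|z|) ->
  finitely_valued (T := borel_dual R G)
    (fun gamma => Num.truncn ((phi ((gamma : pontryagin_dual R G) g) + 1) * n.+1%:R)).
Proof.
move=> phi1 phi_le.
have bound (gamma : pontryagin_dual R G) : 0 <= (phi (gamma g) + 1) * n.+1%:R <= 2 * n.+1%:R.
  have : `|phi (gamma g)| <= 1 by rewrite -lecR; apply: le_trans (phi_le _) _; rewrite char_norm1.
  rewrite ler_norml => /andP[lo hi]; apply/andP; split.
    by rewrite mulr_ge0// -lerBlDr sub0r.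
  by rewrite ler_wpM2r// -lerBrDr (le_trans hi)// lerBrDr -[1 + 1]/(2%:R).
split.
  apply: (sub_finite_set _ (finite_II (2 * n.+1).+1)) => _ [gamma _ <-] /=.
  have /andP[lo hi] := bound gamma.
  have /andP[tr _] := truncn_itv lo.
  by rewrite ltnS -(ler_nat R) natrM (le_trans tr).
move=> k.
pose U (c : R) : set (pontryagin_dual R G) :=
  [set gamma | (phi (gamma g) + 1) * n.+1%:R < c].
have mU c : measurable (U c : set (borel_dual R G)).
  by apply: sub_sigma_algebra; exact: open_char_lt.
rewrite (_ : _ @^-1` _ = (U k.+1%:R : set (borel_dual R G)) `\` U k%:R); first exact: measurableD.
apply/seteqP; split=> gamma /=; have /andP[lo hi] := bound gamma; rewrite /U /=.
  move=> <-; have /andP[tr1 tr2] := truncn_itv lo.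
  by split=> //; apply/negP; rewrite -leNgt.
move=> [lt /negP]; rewrite -leNgt => ge; apply/eqP; rewrite truncn_eq//.
by rewrite ge lt.
Qed.

Lemma truncn_approx (y : R) (n : nat) : `|y| <= 1 ->
  `|y - ((Num.truncn ((y + 1) * n.+1%:R))%:R / n.+1%:R - 1)| <= n.+1%:R^-1.
Proof.
rewrite ler_norml => /andP[lo hi].
have y0 : 0 <= (y + 1) * n.+1%:R by rewrite mulr_ge0// -lerBlDr sub0r.
have /andP[tr1 tr2] := truncn_itv y0.
set k := Num.truncn _ in tr1 tr2 *.
rewrite opprB addrA ger0_norm; last by rewrite subr_ge0 ler_pdivrMr.
rewrite lerBlDr -[X in _ <= X + _]mul1r -mulrDl ler_pdivlMr// nat1r.
exact: ltW.
Qed.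

(** Rounding the real and imaginary parts of [gamma g].  All translates of the
    approximating map must be simple for the orthogonality argument; they are, because
    translating only replaces [gamma g] by [gamma0 g * gamma g] before rounding. *)
Lemma exists_simple_char (V : normedModType R[i]) (g : G) (x : V) (e : R[i]) : 0 < e ->
  exists2 s : pontryagin_dual R G -> V,
    forall gamma, simple_map (T := borel_dual R G) (fun delta => s (gamma * delta)%g) &
    forall gamma, `|gamma g *: x - s gamma| <= e.
Proof.
move=> /gt0_complex[-> e0]; set e' := complex.Re e in e0 *.
set r := complex.Re `|x|.
have r0 : 0 <= r by rewrite -lecR -norm_complex normr_ge0.
pose n := Num.bound (2 * r / e').
pose q (k : nat) : R := k%:R / n.+1%:R - 1.
pose lev (phi : R[i] -> R) gamma := Num.truncn ((phi (gamma g) + 1) * n.+1%:R).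
pose f (kl : nat * nat) : V := (q kl.1 +i* q kl.2) *: x.
have flev (phi : R[i] -> R) gamma : (forall z w, `|phi z - phi w|%:C <= `|z - w|) ->
    (forall z, `|phi z|%:C <= `|z|) ->
    finitely_valued (T := borel_dual R G) (fun delta => lev phi (gamma * delta)%g).
  move=> phi1 phi_le.
  apply: (@finitely_valued_truncn (fun z => phi (gamma g * z))) => [z w|z].
    by apply: le_trans (phi1 _ _) _; rewrite -mulrBr normrM char_norm1 mul1r.
  by apply: le_trans (phi_le _) _; rewrite normrM char_norm1 mul1r.
exists (fun gamma => f (lev (@complex.Re R) gamma, lev (@complex.Im R) gamma)).
  move=> gamma.
  have fRe : finitely_valued (T := borel_dual R G)
      (fun delta => lev (@complex.Re R) (gamma * delta)%g).
    by apply: flev => [z w|z]; rewrite -?raddfB; exact: normc_ge_Re.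
  have fIm : finitely_valued (T := borel_dual R G)
      (fun delta => lev (@complex.Im R) (gamma * delta)%g).
    by apply: flev => [z w|z]; rewrite -?raddfB; exact: Im_norm_le.
  have fvc := finitely_valued_comp (finitely_valued_pair fRe fIm) f.
  exact: fvc.
move=> gamma; rewrite /f /= -scalerBl normrZ (norm_complex x) -/r.
set a := lev _ _; set b := lev _ _.
have aP : `|complex.Re (gamma g) - q a| <= n.+1%:R^-1.
  apply: truncn_approx; rewrite -lecR; apply: le_trans (normc_ge_Re _) _.
  by rewrite char_norm1.
have bP : `|complex.Im (gamma g) - q b| <= n.+1%:R^-1.
  apply: truncn_approx; rewrite -lecR; apply: le_trans (Im_norm_le _) _.
  by rewrite char_norm1.
have le2 : `|gamma g - (q a +i* q b)| <= (2 / n.+1%:R)%:C.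
  apply: le_trans (norm_le_ReD_Im _) _.
  rewrite lecR [complex.Re _]raddfB [complex.Im _]raddfB /= mulrDl mul1r.
  exact: lerD.
apply: (@le_trans _ _ ((2 / n.+1%:R)%:C * r%:C)); first by rewrite ler_wpM2r// lecR.
rewrite -rmorphM lecR mulrAC ler_pdivrMr// -ler_pdivrMl// mulrC.
apply: ltW; apply: lt_le_trans (archi_boundP _) _; last by rewrite ler_nat.
by rewrite divr_ge0// ?mulr_ge0// ltW.
Qed.

Context (mu : probability (borel_dual R G) R).
Hypothesis haar_mu : normalised_haar mu.

Lemma haar_translate gamma (E : set (borel_dual R G)) : measurable E ->
  mu ((fun delta => (gamma * delta)%g) @^-1` E) = mu E.
Proof.
move=> mE; have [inv _ _] := haar_mu.
rewrite -[RHS](inv (gamma^-1)%g)//; congr (mu _); apply/seteqP; split=> delta /=.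
  by move=> Egd; exists (gamma * delta)%g => //; rewrite mulgA mulVg mul1g.
by move=> [delta' Ed <-]; rewrite mulgA mulgV mul1g.
Qed.

(** Orthogonality of characters.  For [g != 0], choose [gamma] with [gamma g != 1].
    If [s] approximates the integrand within [d], then [s] translated by [gamma] is within
    [2 * d] of [gamma g *: s] and has the same integral [I], so [|1 - gamma g| |I| <= 2 * d]. *)
Lemma uniform_integral_char (V : normedModType R[i]) (g : G) (x : V) :
  uniform_integral mu (fun gamma : borel_dual R G => (gamma : pontryagin_dual R G) g *: x)
    (if g == 0 then x else 0).
Proof.
have [->|g0] := eqVneq g 0.
  rewrite (_ : (fun gamma : borel_dual R G => _) = fun=> x); first exact: uniform_integral_cst.
  by apply/funext => gamma; rewrite char0 scale1r.
have [gamma gamma1] := @characters_separate R G g g0.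
move=> e e0; set c := `|1 - gamma g|.
have c0 : 0 < c by rewrite normr_gt0 subr_eq0 eq_sym.
have c2 : c <= 2 by apply: le_trans (ler_normB _ _) _; rewrite normr1 char_norm1.
have d0 : 0 < e * c / 2 by rewrite divr_gt0// mulr_gt0.
have [s ssg sP] := exists_simple_char g x d0.
have ss : simple_map (T := borel_dual R G) s.
  rewrite (_ : s = fun delta => s (1 * delta)%g); first exact: ssg.
  by apply/funext => delta; rewrite mul1g.
exists s; split=> //.
  by move=> delta; apply: le_trans (sP _) _; rewrite ler_pdivrMr// ler_wpM2l// ltW.
rewrite sub0r normrN.
pose tau (delta : borel_dual R G) : borel_dual R G :=
  (gamma * (delta : pontryagin_dual R G))%g.
have tau_surj t : exists t', tau t' = t.
  by exists ((gamma^-1 * (t : pontryagin_dual R G))%g); rewrite /tau mulgA mulgV mul1g.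
have st : simple_map (s \o tau) := ssg gamma.
have inv : simple_integral mu (s \o tau) = simple_integral mu s.
  by apply: simple_integral_invariant => //; exact: haar_translate.
rewrite -(ler_pM2l c0) -normrZ scalerBl scale1r -{1}inv -scaleNr.
rewrite -simple_integralZ// -simple_integralD//; last exact: simple_mapZ.
apply: norm_simple_integral_le; first by apply: simple_mapD => //; exact: simple_mapZ.
move=> delta /=; rewrite scaleNr.
have -> : s (tau delta) - gamma g *: s delta =
    gamma g *: ((delta : pontryagin_dual R G) g *: x - s delta) -
    (tau delta g *: x - s (tau delta)).
  rewrite scalerBr scalerA opprB [RHS]addrC [RHS]addrA; congr (_ - _).
  exact: (esym (addrNK _ _)).
apply: le_trans (ler_normB _ _) _.
rewrite normrZ char_norm1 mul1r mulrC [leRHS]splitr.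
by apply: lerD; exact: sP.
Qed.

End HaarIntegral.

Section Averaging.
Context {R : realType} {G : zmodType} {A : cstarAlgType R}.
Context (Agr : G -> set A) (F : {linear A -> A}).
Hypothesis gradedA : topologically_graded_by Agr F.
Context (mu : probability (borel_dual R G) R).
Hypothesis haar_mu : normalised_haar mu.

Lemma uniform_integral_twisted_sum (L : seq (G * A)) : homogeneous Agr L ->
  uniform_integral mu (fun gamma : borel_dual R G => twisted_sum gamma L) (F (total L)).
Proof.
elim: L => [|p L IH] hL.
  rewrite totalE big_nil linear0 (_ : (fun gamma : borel_dual R G => _) = fun=> 0).
    exact: uniform_integral_cst.
  by apply/funext => gamma; rewrite /twisted_sum big_nil.
rewrite totalE big_cons -totalE linearD (F_Agr gradedA (hL p (mem_head _ _))).
rewrite (_ : (fun gamma : borel_dual R G => _) =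
    fun gamma : borel_dual R G => (gamma : pontryagin_dual R G) p.1 *: p.2 + twisted_sum gamma L).
  apply: uniform_integralD; first exact: uniform_integral_char.
  by apply: IH => q qL; apply: hL; rewrite inE qL orbT.
by apply/funext => gamma; rewrite /twisted_sum big_cons.
Qed.

Lemma uniform_integral_alpha (alpha : pontryagin_dual R G -> A -> A) :
  (forall gamma a L, homogeneous Agr L ->
    `|alpha gamma a - twisted_sum gamma L| <= `|a - total L|) ->
  forall a, uniform_integral mu (fun gamma : borel_dual R G => alpha gamma a) (F a).
Proof.
move=> alphaP a; apply: uniform_integral_lim => e e0.
(* [K >= 1] bounds [F], so closeness within [e / K] serves both [alpha] and [F] *)
have [_ [M FM] _ _] := gradedA.
pose K : R[i] := (`|M| + 1)%:C.
have K1 : 1 <= K by rewrite lecR lerDr.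
have K0 : 0 < K := lt_le_trans ltr01 K1.
have [L hL lt] := dense_homogeneous gradedA a (divr_gt0 e0 K0).
have leK : K * `|a - total L| <= e by rewrite mulrC -ler_pdivlMr// ltW.
exists (fun gamma => twisted_sum gamma L), (F (total L)); split.
- exact: uniform_integral_twisted_sum.
- move=> gamma; apply: le_trans (alphaP _ _ _ hL) _; apply: le_trans leK.
  by rewrite ler_peMl.
- rewrite -linearB; apply: le_trans (FM _) _; apply: le_trans leK.
  by rewrite ler_wpM2r// lecR (le_trans (ler_norm _))// lerDl.
Qed.

End Averaging.

Theorem theorem3 (R : realType) (G : zmodType) (A : cstarAlgType R)
    (Agr : G -> set A) (F : {linear A -> A})
    (gradedA : topologically_graded_by Agr F) :
  exists alpha : pontryagin_dual R G -> A -> A,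
    [/\ strongly_continuous_action alpha,
        forall (g : G) (a : A) (gamma : pontryagin_dual R G),
          Agr g a -> alpha gamma a = gamma g *: a &
        forall mu : probability (borel_dual R G) R, normalised_haar mu ->
          forall a : A,
            is_bochner_integral mu (fun gamma => alpha gamma a) (F a)].
Proof.
have [alpha alphaP] := exists_dual_extension gradedA.
exists alpha; split.
- split.
  + exact: (alpha_star_automorphism gradedA).
  + exact: (alpha_comp gradedA).
  + exact: (alpha_continuous gradedA).
- move=> g a gamma ga.
  have hL : homogeneous Agr [:: (g, a)] by move=> p; rewrite inE => /eqP->.
  have := alpha_total alphaP gamma hL.
  by rewrite /total /twisted_sum !big_seq1 scale1r.
- move=> mu haar_mu a; apply: bochner_of_uniform.
  exact: (uniform_integral_alpha gradedA haar_mu alphaP).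
Qed.
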